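(* Let $\mathbf f=f_0f_1\cdots$ be the Fibonacci word, $f_{t-1}=\lfloor (t+1)\gamma\rfloor-\lfloor t\gamma\rfloor$ ($t\ge1$), $\gamma=(3-\sqrt5)/2$, and call a pair $(m,n)$ of natural numbers balanced if $T(i,m,n)=\sum_{k=0}^{m-1}\sum_{\ell=0}^{n-1}f_{i+k+\ell}$ takes at most two distinct values over $i\ge0$. Assume $m\le n$, and let the Zeckendorf expansions be $m=F_{a_1}+\cdots+F_{a_k}$ with $a_1>\cdots>a_k$ and $n=F_{b_1}+\cdots+F_{b_\ell}$ with $b_1>\cdots>b_\ell$. Then $(m,n)$ is balanced if and only if at least one of the following holds: (a) $m=0$ or $m=1$; (b) $m=F_{a_1}$, $a_1\notin\{b_1,\ldots,b_\ell\}$, and for the index $j$ with $b_j>a_1>b_{j+1}$, the indices $a_1$ and $b_j$ have the same parity; (c) $m=F_{a_1}$ and $a_1\in\{b_1,\ldots,b_\ell\}$; (d) $a_1=b_\ell$ and $b_\ell$, $b_{\ell-1}$ have distinct parities; (e) $a_1<b_\ell$.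
   Context: Fibonacci numbers: $F_0=0$, $F_1=1$, $F_{t+1}=F_t+F_{t-1}$. Zeckendorf expansion: every $N\ge 0$ is uniquely a sum of Fibonacci numbers $F_{c}$ with indices $c\ge2$, pairwise differing by at least $2$ (the empty sum for $N=0$). *)

(* Defs.v *)
From mathcomp Require Import all_boot all_order all_algebra.
From mathcomp Require Import reals.

Set Implicit Arguments.
Unset Strict Implicit.
Unset Printing Implicit Defensive.

Import Order.TTheory GRing.Theory Num.Theory.

Local Open Scope ring_scope.

Fixpoint fib (t : nat) : nat :=
  match t with
  | 0 => 0
  | t'.+1 => match t' with 0 => 1 | t''.+1 => fib t' + fib t'' end
  end%N.

Definition gamma (R : realType) : R := (3 - Num.sqrt 5) / 2.

(* [fib_word R t] is the letter f_t with t counted from 0, hence the shift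
   with respect to f_(t-1) = floor ((t+1) gamma) - floor (t gamma), t >= 1. *)
Definition fib_word (R : realType) (t : nat) : int :=
  Num.floor (t.+2%:R * gamma R) - Num.floor (t.+1%:R * gamma R).

Definition rect_sum (R : realType) (i m n : nat) : int :=
  \sum_(k < m) \sum_(l < n) fib_word R (i + k + l).

Definition balanced (R : realType) (m n : nat) : Prop :=
  exists x y : int,
    forall i, rect_sum R i m n = x \/ rect_sum R i m n = y.

(* The indices c are listed in decreasing order; [pairwise] relates every
   entry to all the later ones. *)
Definition zeckendorf (N : nat) (c : seq nat) : Prop :=
  [/\ all (fun x => 2 <= x)%N c,
      pairwise (fun x y => y + 2 <= x)%N c
    & N = (\sum_(x <- c) fib x)%N].

(* s_j with j counted from 1; 0 is a junk value outside 1 <= j <= size s. *)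
Definition entry (s : seq nat) (j : nat) : nat := nth 0%N s j.-1.

(* Main.v *)
(* Let psi = (1 - sqrt 5)/2, so that gamma = psi + 1 = psi^2 and, modulo 1,
   F_c gamma = psi^c.  The sum T(i,m,n) counts, up to a constant, the points
   k gamma (k < m) lying in an arc of length {n gamma} whose position moves
   with i.  As that arc moves, the count jumps up at the points -(n+k) gamma
   and down at the points -k gamma, so it takes at most two values iff these
   two families of m points alternate on the circle.  Comparing each jump with
   its translate by gamma, this happens iff for all 0 < j < m
     floor((m+n-j)gamma) - floor((n-j)gamma) - floor((m-j)gamma)
       + floor(-j gamma) = 0.
   If s is a signed distance from n gamma to an integer, the j-th condition
   says that j gamma lies between 0 and s modulo 1 iff (m-j) gamma lies between
   0 and -s; exchanging m and n gives a second form of the same condition.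
   With a = a_1, the points j gamma with 0 < j < F_(a+1) stay at distance at
   least |psi^a| from 0 modulo 1.  Hence (m,n) is balanced if
   ||n gamma|| <= |psi^a|, as happens in (d) and (e).  Otherwise, if m is
   not a Fibonacci number, one of the points F_a gamma, F_(a-1) gamma lies
   between 0 and the shorter of m gamma, n gamma, and the balance fails.  If
   m = F_a, balance means that no t with n - m < t < n has t gamma between 0
   and -psi^a; the only candidate is the part of the expansion of n with
   indices above a, which gives (b) and (c). *)
Require Import Defs.
From mathcomp Require Import all_boot all_order all_algebra.
From mathcomp Require Import reals.
From mathcomp Require Import zify ring lra.

Set Implicit Arguments.
Unset Strict Implicit.
Unset Printing Implicit Defensive.

Import Order.TTheory GRing.Theory Num.Theory.

Local Open Scope ring_scope.

#[local] Arguments fib : simpl never.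

(** * Fibonacci multiples of gamma *)

Lemma fibSS c : fib c.+2 = (fib c.+1 + fib c)%N.
Proof. by []. Qed.

Lemma fib_gt0 c : (0 < fib c.+1)%N.
Proof. by elim: c => // c IH; rewrite fibSS; lia. Qed.

Lemma leq_fib c d : (c <= d)%N -> (fib c <= fib d)%N.
Proof.
move=> /subnK <-; elim: (d - c)%N => // k IH; rewrite addSn.
apply: leq_trans IH _; case: (k + c)%N => // j.
by rewrite fibSS leq_addr.
Qed.

Lemma fib_ge c : (c <= fib c.+2)%N.
Proof. by elim: c => // c IH; rewrite fibSS; have := fib_gt0 c; lia. Qed.

(** The two vectors have determinant plus or minus 1, hence span [Z^2]; one Fibonacci step turns the
    coordinates [(u, v)] into [(v, u - v)]. *)
Lemma fib_basis k (d z : int) : exists u v : int,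
  d = u * (fib k.+3)%:Z + v * (fib k.+2)%:Z /\
  z = u * (fib k.+1)%:Z + v * (fib k)%:Z.
Proof.
elim: k => [|k [u [v [-> ->]]]]; first by exists z, (d - 2 * z); rewrite /fib; lia.
exists v, (u - v); rewrite (fibSS k.+2) (fibSS k.+1) (fibSS k); lia.
Qed.

Section Golden.
Variable R : realType.

Definition psi : R := (1 - Num.sqrt 5) / 2.

Lemma psi_sqr : psi ^+ 2 = psi + 1.
Proof.
have h : Num.sqrt 5 ^+ 2 = 5 :> R by rewrite sqr_sqrtr.
rewrite /psi; move: h; set s := Num.sqrt 5 => h.
have -> : ((1 - s) / 2) ^+ 2 = (1 - 2 * s + s ^+ 2) / 4 by field.
by rewrite h; field.
Qed.

Lemma gammaE : gamma R = psi + 1.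
Proof. by rewrite /gamma /psi; field. Qed.

Lemma psi_bound : - (2 / 3) < psi < - (1 / 2).
Proof.
have h : Num.sqrt 5 ^+ 2 = 5 :> R by rewrite sqr_sqrtr.
have := sqrtr_ge0 (5 : R).
rewrite /psi; move: h; set s := Num.sqrt 5 => h s0; apply/andP; split; nra.
Qed.

#[local] Opaque psi.

Lemma psi_neq0 k : psi ^+ k != 0.
Proof. by rewrite expf_neq0 //; have := psi_bound; lra. Qed.

Lemma psiX_gt0 k : 0 < `|psi ^+ k|.
Proof. by rewrite normr_gt0 psi_neq0. Qed.

Lemma psiSS k : psi ^+ k.+2 = psi ^+ k.+1 + psi ^+ k.
Proof. by rewrite -addn2 exprD psi_sqr exprS; ring. Qed.

Lemma norm_psi : `|psi| = - psi.
Proof. by rewrite ler0_norm //; have := psi_bound; lra. Qed.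

Lemma psiX_sign k : psi ^+ k = (-1) ^+ odd k * `|psi ^+ k|.
Proof. by rewrite normrX norm_psi signr_odd -exprMn mulN1r opprK. Qed.

Lemma norm_psiS k : `|psi ^+ k.+1| = - psi * `|psi ^+ k|.
Proof. by rewrite exprS normrM norm_psi. Qed.

Lemma norm_psiX_lt k l : (k < l)%N -> `|psi ^+ l| < `|psi ^+ k|.
Proof.
move=> /subnK <-; elim: (l - _)%N => [|i IH]; rewrite ?addSn ?add0n norm_psiS.
  by have := psiX_gt0 k; have := psi_bound; nra.
by apply: le_lt_trans IH; have := psiX_gt0 (i + k.+1); have := psi_bound; nra.
Qed.

Lemma norm_psiX_le k l : (k <= l)%N -> `|psi ^+ l| <= `|psi ^+ k|.
Proof. by rewrite leq_eqVlt => /orP[/eqP->//|/norm_psiX_lt/ltW]. Qed.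

Lemma fib_gamma c : (fib c.+2)%:R * gamma R = (fib c)%:R + psi ^+ c.+2.
Proof.
rewrite gammaE.
suff [] : (fib c.+2)%:R * (psi + 1) = (fib c)%:R + psi ^+ c.+2 /\
  (fib c.+3)%:R * (psi + 1) = (fib c.+1)%:R + psi ^+ c.+3 by [].
elim: c => [|c [IH1 IH2]].
  by rewrite /fib /= (psiSS 1) psi_sqr; split; rewrite ?expr1; ring.
split=> //; rewrite (fibSS c.+2) natrD mulrDl IH2 IH1 (psiSS c.+2).
by rewrite (fibSS c) natrD; ring.
Qed.

(* Writing [(d, z)] in the basis [(F_(k+3), F_(k+1))], [(F_(k+2), F_k)] of
   [Z^2], the bounds on [d] force coordinates [u, v] of opposite signs. *)
Lemma gamma_approx k (d z : int) : 0 < d < (fib k.+3)%:Z ->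
  exists t : R, d%:~R * gamma R - z%:~R = psi ^+ k.+2 * t /\
    (1 <= t \/ t <= psi - 1).
Proof.
move=> hd; have [u [v [dE zE]]] := fib_basis k d z.
exists (u%:~R * psi + v%:~R); split.
  rewrite dE zE !rmorphD !rmorphM /= -!pmulrn.
  have := fib_gamma k; have := fib_gamma k.+1; rewrite (exprS _ k.+2).
  move: psi (gamma R) (psi ^+ k.+2) => q G p h1 h2.
  by rewrite mulrDl -!mulrA h1 h2; ring.
have p := psi_bound; have F1 := fib_gt0 k.+2; have F2 := fib_gt0 k.+1.
have [v0|v0] : v >= 1 \/ v <= -1.
  suff : v != 0 by lia.
  by apply/eqP => v0; have [u0|u0] : u <= 0 \/ u >= 1; subst v; (lia || nia).
- left; have u0 : u <= 0 by nia.
  have : (1 : R) <= v%:~R by rewrite (ler_int R 1).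
  have : u%:~R <= (0 : R) by rewrite (ler_int R _ 0).
  nra.
- right; have u0 : u >= 1 by nia.
  have : v%:~R <= (-1 : R) by rewrite (ler_int R _ (-1)).
  have : (1 : R) <= u%:~R by rewrite (ler_int R 1).
  nra.
Qed.

(** Best approximation: both ranges of the factor in [gamma_approx] have absolute value at least
    1. *)
Lemma gamma_dist k (d z : int) : d != 0 -> `|d| < (fib k.+3)%:Z ->
  `|psi ^+ k.+2| <= `|d%:~R * gamma R - z%:~R|.
Proof.
wlog d0 : d z / 0 < d => [H dn0 dlt|_ dlt].
  have [d0|d0] : 0 < d \/ d < 0 by lia.
    exact: H.
  have := H (- d) (- z); rewrite normrN !rmorphN /= mulNr -opprD normrN.
  by apply=> //; lia.
have [|t [-> ht]] := @gamma_approx k d z; first by lia.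
rewrite [leRHS]normrM ler_peMr //; have p := psi_bound.
by rewrite ler_normr; case: ht => ht; lra.
Qed.

Lemma gamma_irrational (d z : int) : d != 0 -> d%:~R * gamma R != z%:~R.
Proof.
move=> d0; rewrite -subr_eq0 -normr_gt0.
apply: lt_le_trans (@gamma_dist `|d|%N d z d0 _); first exact: psiX_gt0.
by have := fib_ge (`|d|%N.+1); lia.
Qed.

Definition beatty (k : int) : int := Num.floor (k%:~R * gamma R).

Lemma beattyN k : k != 0 -> beatty (- k) = - beatty k - 1.
Proof.
move=> k0; apply: floor_def; have := floor_itv (k%:~R * gamma R).
have := gamma_irrational (Num.floor (k%:~R * gamma R)) k0.
rewrite !(rmorphN, rmorphD, rmorphB) /= => h /andP[h1 h2].
have : (Num.floor (k%:~R * gamma R))%:~R < k%:~R * gamma R.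
  by rewrite lt_neqAle eq_sym h h1.
by lra.
Qed.

(** By [fib_gamma] the shift is [psi^c] modulo 1, shorter than the distance from [d gamma] to any
    integer when [d] is nonzero, so no integer is crossed. At [d = 0] the floor drops exactly when
    [psi^c < 0]. *)
Lemma beattyD_fib c (d : int) : (3 <= c)%N -> `|d| < (fib c)%:Z ->
  beatty ((fib c)%:Z + d) = (fib (c - 2))%:Z + beatty d - (odd c && (d == 0))%:Z.
Proof.
case: c => [|[|[|k]]] // _ hd; rewrite subSS subn1 /=.
rewrite /beatty; apply: floor_def.
have E : ((fib k.+3)%:Z + d)%:~R * gamma R = (fib k.+1)%:R + psi ^+ k.+3 + d%:~R * gamma R.
  by rewrite rmorphD /= -pmulrn mulrDl fib_gamma.
rewrite E; have := floor_itv (d%:~R * gamma R); set f := Num.floor _ => /andP[f1 f2].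
rewrite !(rmorphD, rmorphB) /= -!pmulrn.
have P := @norm_psiX_lt k.+2 k.+3 (ltnSn _).
have P0 := psiX_gt0 k.+3; rewrite rmorphD /= in f2.
move: (psiX_sign k.+3); rewrite /= negbK.
have [d0|d0] := eqVneq d 0.
  have f0 : f = 0 by rewrite /f d0 mul0r floor0.
  rewrite f0 d0 andbT /=.
  have : `|psi ^+ k.+3| < 1 by have := @norm_psiX_lt 0 k.+3 isT; rewrite expr0 normr1.
  case: (odd k) => /=;
  by rewrite ?expr0 ?expr1 ?rmorphN /= ?mulr0z ?mulr1z ?mul0r => *; lra.
have D1 := gamma_dist f d0 hd; have D2 := gamma_dist (f + 1) d0 hd.
rewrite rmorphD /= in D2; rewrite mulr1z in f2 D2.
rewrite [leRHS]ger0_norm in D1; last by lra.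
rewrite [leRHS]ler0_norm in D2; last by lra.
rewrite andbF; case: (odd k) => /=;
by rewrite ?expr0 ?expr1 ?rmorphN /= ?mulr0z ?mulr1z ?mul0r => *; lra.
Qed.

(** * Balance as a condition on second differences *)

Lemma rect_sumE i m n : rect_sum R i m n =
  \sum_(k < m) (beatty (i.+1 + k + n)%N - beatty (i.+1 + k)%N).
Proof.
apply: eq_bigr => k _; rewrite -(big_mkord xpredT (fun l => fib_word R (i + k + l))).
under eq_bigr => l _ do rewrite /fib_word.
rewrite (@telescope_sumr_eq _ _ _ (fun l => beatty (i.+1 + k + l)%N)) //.
  by rewrite addn0.
by move=> l _; rewrite /beatty -!pmulrn -!addSn addnS.
Qed.

(* The value at [x = - p gamma], just after the jump there, of the function
   [x |-> sum_(k < m) (floor (x + (n + k) gamma) - floor (x + k gamma))], whose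
   value at [x = (i + 1) gamma] is [rect_sum i m n]. *)
Definition pivot_sum (m n : nat) (p : int) : int :=
  \sum_(k < m) (beatty ((n + k)%N%:Z - p) - beatty (k%:Z - p)).

Definition second_diff (m n : nat) (p : int) : int :=
  beatty ((m + n)%N%:Z - p) - beatty (n%:Z - p) - beatty (m%:Z - p) + beatty (- p).

Lemma second_diffC m n p : second_diff m n p = second_diff n m p.
Proof. by rewrite /second_diff addnC; lia. Qed.

Lemma pivot_sumB m n (p : int) :
  pivot_sum m n (p - 1) - pivot_sum m n p = second_diff m n p.
Proof.
rewrite /pivot_sum -sumrB.
rewrite -(big_mkord xpredT (fun k =>
  beatty ((n + k)%N%:Z - (p - 1)) - beatty (k%:Z - (p - 1)) -
  (beatty ((n + k)%N%:Z - p) - beatty (k%:Z - p)))).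
rewrite (@telescope_sumr_eq _ _ _ (fun k => beatty ((n + k)%N%:Z - p) - beatty (k%:Z - p))) //.
  by rewrite addn0 sub0r /second_diff [(m + n)%N]addnC; ring.
move=> k _; rewrite addnS.
have -> : (n + k)%N%:Z - (p - 1) = (n + k).+1%:Z - p by lia.
have -> : k%:Z - (p - 1) = k.+1%:Z - p by lia.
by [].
Qed.

(** The reflection [p -> m + n - p] sends the four arguments of the floors to their negatives, and
    the constants from [beattyN] cancel. It exchanges downward and upward jumps. *)
Lemma second_diff_reflect m n j : (0 < j < m)%N -> (m <= n)%N ->
  second_diff m n (n + j)%N = - second_diff m n (m - j)%N.
Proof.
move=> hj le_mn; rewrite /second_diff.
have -> : (m + n)%N%:Z - (n + j)%N%:Z = (m - j)%N%:Z by lia.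
have -> : n%:Z - (n + j)%N%:Z = - j%:Z by lia.
have -> : m%:Z - (n + j)%N%:Z = - (n + j - m)%N%:Z by lia.
have -> : (m + n)%N%:Z - (m - j)%N%:Z = (n + j)%N%:Z by lia.
have -> : n%:Z - (m - j)%N%:Z = (n + j - m)%N%:Z by lia.
have -> : m%:Z - (m - j)%N%:Z = j%:Z by lia.
by rewrite !beattyN; lia.
Qed.

Lemma beattyB_frac (k l : int) :
  k%:~R * gamma R - (beatty k)%:~R <= l%:~R * gamma R - (beatty l)%:~R ->
  beatty l = beatty k + beatty (l - k).
Proof.
move=> h; suff -> : beatty (l - k) = beatty l - beatty k by lia.
rewrite {1}/beatty; apply: floor_def.
have := floor_itv (k%:~R * gamma R); have := floor_itv (l%:~R * gamma R).
rewrite -/(beatty k) -/(beatty l) !(rmorphB, rmorphD) /= !mulr1z.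
by move=> /andP[? ?] /andP[? ?]; lra.
Qed.

(* The pivot is the index whose multiple of [gamma] has the least fractional
   part, so subtracting it creates no carry in the other floors. *)
Lemma rect_sum_pivot i m n : (0 < m <= n)%N ->
  exists2 p : nat, (p < m)%N || (n <= p < n + m)%N & rect_sum R i m n = pivot_sum m n p.
Proof.
move=> /andP[m0 le_mn].
pose P := [pred k : 'I_(n + m) | (k < m)%N || (n <= k)%N].
pose fr (k : nat) : R := (i.+1 + k)%N%:~R * gamma R - (beatty (i.+1 + k)%N)%:~R.
have h0 : (0 < n + m)%N by lia.
have P0 : P (Ordinal h0) by rewrite /= m0.
case: (arg_minP (fun k : 'I_(n + m) => fr k) P0) => p /= Pp minp.
exists p; first by have := ltn_ord p; move: Pp; lia.
have key k : (k < n + m)%N -> (k < m)%N || (n <= k)%N ->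
    beatty (i.+1 + k)%N = beatty (i.+1 + p)%N + beatty (k%:Z - (p : nat)%:Z).
  move=> hk Pk; have -> : k%:Z - (p : nat)%:Z = (i.+1 + k)%N%:Z - (i.+1 + p)%N%:Z by lia.
  by apply: beattyB_frac; apply: (minp (Ordinal hk)).
rewrite rect_sumE; apply: eq_bigr => k _; have hk := ltn_ord k.
rewrite -addnA [(k + n)%N]addnC (key (n + k)%N) ?(key k); [ring|lia..].
Qed.

(* For [i + 1 = F_c - p] the phase is [psi^c - p gamma] modulo 1, on the right
   or on the left of the jump at [- p gamma] according to the parity of [c]. *)
Lemma pivot_sum_attained m n p c : (p < n + m)%N -> (n + m + 3 < fib c)%N ->
  ~~ odd c || (p < m <= n)%N ->
  exists i, rect_sum R i m n = pivot_sum m n p + (odd c)%:Z.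
Proof.
move=> hp hc ho; exists (fib c - p.+1)%N.
have c3 : (3 <= c)%N by case: c hc {ho} => [|[|[|c]]] //; rewrite /fib /=; lia.
have key (q : nat) : (q < n + m)%N -> beatty ((fib c - p.+1).+1 + q)%N =
    (fib (c - 2))%:Z + beatty (q%:Z - p%:Z) - (odd c && (q%:Z - p%:Z == 0))%:Z.
  by move=> hq; rewrite -beattyD_fib //; [congr beatty|]; lia.
rewrite rect_sumE /pivot_sum.
have -> : (odd c)%:Z = \sum_(k < m) (odd c && (k == p :> nat))%:Z.
  case: (boolP (odd c)) ho => [_ /= hpm|_ _]; last by rewrite big1.
  have pm : (p < m)%N by lia.
  rewrite (bigD1 (Ordinal pm)) //= eqxx big1 ?addr0 // => k.
  by rewrite -val_eqE /= => /negbTE->.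
rewrite -big_split /=; apply: eq_bigr => k _; have hk := ltn_ord k.
rewrite -addnA [(k + n)%N]addnC (key (n + k)%N) ?(key k); [|lia..].
case: (odd c) ho => /= ho; last by lia.
have -> : ((n + k)%N%:Z - p%:Z == 0) = false by lia.
have -> : (k%:Z - p%:Z == 0) = (k == p :> nat) by lia.
lia.
Qed.

(** Large Fibonacci indices of both parities attain the values on either side of the downward jump
    at [- p gamma], so these consecutive integers are [x] and [y]. *)
Lemma balanced_pivots m n x y p : (0 < m <= n)%N ->
  (forall i, rect_sum R i m n = x \/ rect_sum R i m n = y) ->
  (p < m)%N ->
  (pivot_sum m n p = x /\ pivot_sum m n p + 1 = y) \/
  (pivot_sum m n p = y /\ pivot_sum m n p + 1 = x).
Proof.
move=> hm hxy hp.
have big : (n + m + 3 < fib (n + m + 3).+3)%N.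
  by have := fib_ge (n + m + 3).+1; lia.
have big2 : (n + m + 3 < fib (n + m + 3).+4)%N.
  by have := fib_ge (n + m + 3).+2; lia.
have [c [hc oc]] : exists c, (n + m + 3 < fib c)%N /\ odd c.
  case: (boolP (odd (n + m + 3).+3)) => o; first by exists (n + m + 3).+3.
  by exists (n + m + 3).+4.
have [d [hd od]] : exists c, (n + m + 3 < fib c)%N /\ ~~ odd c.
  case: (boolP (odd (n + m + 3).+3)) => o; last by exists (n + m + 3).+3.
  by exists (n + m + 3).+4; split=> //; rewrite /= -/(odd _) in o *; rewrite o.
have [|||i hi] := @pivot_sum_attained m n p c; rewrite ?hp ?orbT //; try lia.
have [|||i' hi'] := @pivot_sum_attained m n p d; rewrite ?hp ?orbT //; try lia.
by have := hxy i; have := hxy i'; rewrite hi hi' oc (negbTE od); lia.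
Qed.

Lemma balancedP m n : (0 < m <= n)%N ->
  balanced R m n <-> forall j, (0 < j < m)%N -> second_diff m n j = 0.
Proof.
move=> hm; split=> [[x [y hxy]] j hj|D0].
  have h1 := @balanced_pivots m n x y j hm hxy.
  have h2 := @balanced_pivots m n x y j.-1 hm hxy.
  rewrite -pivot_sumB; have -> : j%:Z - 1 = j.-1%:Z by lia.
  by have := h1 ltac:(lia); have := h2 ltac:(lia); lia.
(* All pivots below [m] share one value, and all pivots from [n] on share the other. *)
exists (pivot_sum m n 0), (pivot_sum m n n) => i.
have [p pP ->] := rect_sum_pivot i hm.
have low q : (q < m)%N -> pivot_sum m n q = pivot_sum m n 0.
  elim: q => // q IH hq; rewrite -IH; last by lia.
  have := D0 q.+1 ltac:(lia); rewrite -pivot_sumB.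
  have -> : q.+1%:Z - 1 = q%:Z by lia.
  by lia.
have high q : (q < m)%N -> pivot_sum m n (n + q)%N = pivot_sum m n n.
  elim: q => [_|q IH hq]; first by rewrite addn0.
  rewrite -IH; last by lia.
  have := @second_diff_reflect m n q.+1 ltac:(lia) ltac:(lia).
  rewrite (D0 (m - q.+1)%N) -?pivot_sumB; last by lia.
  have -> : (n + q.+1)%N%:Z - 1 = (n + q)%N%:Z by lia.
  by lia.
case/orP: pP => hp; [left; exact: low | right].
have -> : p = (n + (p - n))%N by lia.
by apply: high; lia.
Qed.

(** * Balance in terms of arcs of the circle *)

Definition inside0 (s u : R) : bool := (0 < u < s) || (s < u < 0).

(* Modulo 1, [k gamma] lies strictly between 0 and [s], where [s] may have
   either sign. *)
Definition hits (k : int) (s : R) : Prop :=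
  exists z : int, inside0 s (k%:~R * gamma R - z%:~R).

Lemma inside0N s u : inside0 (- s) (- u) = inside0 s u.
Proof. by rewrite /inside0 oppr_lt0 oppr_gt0 !ltrN2 andbC orbC andbC. Qed.

Lemma inside0_norm s u : inside0 s u -> `|u| < `|s|.
Proof.
case/orP=> /andP[h1 h2]; first by rewrite !gtr0_norm //; lra.
by rewrite !ltr0_norm //; lra.
Qed.

Lemma inside0D s u v : inside0 s u -> inside0 (- s) v -> `|u + v| < `|s|.
Proof.
rewrite /inside0 => h1 h2; have [s0|s0] := ltP 0 s.
  by rewrite (gtr0_norm s0) ltr_norml; lra.
by rewrite (ler0_norm s0) ltr_norml; lra.
Qed.

Lemma inside0_or s u : u != 0 -> `|u| < `|s| -> inside0 s u \/ inside0 (- s) u.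
Proof.
move=> u0; have [h|h] : 0 < u \/ u < 0 by case: (ltgtP u 0) u0 => //; auto.
  rewrite (gtr0_norm h) ltr_normr /inside0.
  by case/orP=> hs; [left|right]; apply/orP; left; lra.
rewrite (ltr0_norm h) ltr_normr /inside0.
by case/orP=> hs; [right|left]; apply/orP; right; lra.
Qed.

Lemma hits_norm k s : hits k s -> exists z : int, `|k%:~R * gamma R - z%:~R| < `|s|.
Proof. by case=> z /inside0_norm; exists z. Qed.

Lemma hitsD k l s : hits k s -> hits l (- s) ->
  exists z : int, `|(k + l)%:~R * gamma R - z%:~R| < `|s|.
Proof.
move=> [y hy] [z hz]; exists (y + z); have := inside0D hy hz.
by congr (`|_| < _); rewrite !rmorphD /=; ring.
Qed.

(** As [|s| < 1], at most one integer separates [x] from [x + s], and the floor moves by the sign of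
    [s] exactly when one does. *)
Lemma floor_shift (x s : R) : `|s| < 1 ->
  (forall z : int, x != z%:~R) -> (forall z : int, x + s != z%:~R) ->
  (Num.floor (x + s) = Num.floor x /\ forall z : int, ~~ inside0 s (z%:~R - x)) \/
  (Num.floor (x + s) = Num.floor x + (if 0 < s then 1 else -1) /\
   exists z : int, inside0 s (z%:~R - x)).
Proof.
rewrite ltr_norml /inside0 => /andP[s1 s2] xz xsz.
have := floor_itv x; set f := Num.floor x; rewrite rmorphD /= mulr1z => /andP[f1 f2].
have f1' : f%:~R < x by rewrite lt_neqAle f1 eq_sym xz.
have noz (z : int) : f%:~R < z%:~R :> R -> z%:~R < f%:~R + 1 :> R -> False.
  by rewrite -[1](mulr1z 1) -rmorphD /= !ltr_int; lia.
have [s0|s0] := ltP 0 s.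
  have [h|h|h] := ltgtP (x + s) (f%:~R + 1).
  - left; split; first by apply: floor_def; rewrite rmorphD /= mulr1z; lra.
    move=> z; apply/negP => hz.
    by apply: (noz z); move: hz; lra.
  - right; split; first by apply: floor_def; rewrite !rmorphD /= !mulr1z; lra.
    by exists (f + 1); rewrite rmorphD /= mulr1z; apply/orP; left; lra.
  - by have := xsz (f + 1); rewrite rmorphD /= mulr1z h eqxx.
have [h|h|h] := ltgtP (x + s) f%:~R.
- right; split; first by apply: floor_def; rewrite !rmorphD !rmorphN /= !mulr1z; lra.
  by exists f; apply/orP; right; lra.
- left; split; first by apply: floor_def; rewrite rmorphD /= mulr1z; lra.
  move=> z; apply/negP => hz.
  by apply: (noz z); move: hz; lra.
- by have := xsz f; rewrite h eqxx.
Qed.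

(** The second difference compares how the shift by [s] changes the floors at [(q - j) gamma] and
    [- j gamma]. By [floor_shift] each change is 0 or the sign of [s], so they agree iff both shifts
    cross an integer or neither does. *)
Lemma second_diff_hits (p q j : nat) (N : int) (s : R) :
  (0 < j < p)%N -> (j < q)%N -> s = p%:R * gamma R - N%:~R -> `|s| < 1 ->
  second_diff p q j = 0 <-> (hits j s <-> hits (q%:Z - j%:Z) (- s)).
Proof.
move=> hj hq sE s1.
have shift (k : int) : beatty (p%:Z + k) = Num.floor (k%:~R * gamma R + s) + N.
  apply: floor_def; have := floor_itv (k%:~R * gamma R + s).
  by rewrite !rmorphD /= -pmulrn !mulr1z sE => /andP[h1 h2]; lra.
have nonint (k : int) : k != 0 -> p%:Z + k != 0 ->
    (forall z : int, k%:~R * gamma R != z%:~R) /\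
    (forall z : int, k%:~R * gamma R + s != z%:~R).
  move=> k0 pk0; split=> z; first exact: gamma_irrational.
  have := gamma_irrational (z + N) pk0; apply: contra_neq => h.
  by rewrite !rmorphD /= -h sE -pmulrn; ring.
have [x1 x2] := @nonint (q%:Z - j%:Z) ltac:(lia) ltac:(lia).
have [y1 y2] := @nonint (- j%:Z) ltac:(lia) ltac:(lia).
have DE : second_diff p q j =
    Num.floor ((q%:Z - j%:Z)%:~R * gamma R + s) -
    Num.floor ((q%:Z - j%:Z)%:~R * gamma R) -
    (Num.floor ((- j%:Z)%:~R * gamma R + s) - Num.floor ((- j%:Z)%:~R * gamma R)).
  rewrite /second_diff; have -> : (p + q)%N%:Z - j%:Z = p%:Z + (q%:Z - j%:Z) by lia.
  by rewrite !shift /beatty; ring.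
have hq' : hits (q%:Z - j%:Z) (- s) <->
    exists z : int, inside0 s (z%:~R - (q%:Z - j%:Z)%:~R * gamma R).
  by split=> -[z hz]; exists z; move: hz; rewrite -inside0N opprB ?opprK.
have hj' : hits j s <-> exists z : int, inside0 s (z%:~R - (- j%:Z)%:~R * gamma R).
  split=> -[z hz]; exists (- z); move: hz; congr is_true; congr inside0;
  by rewrite !rmorphN /=; ring.
have no x : (forall z : int, ~~ inside0 s (z%:~R - x)) <->
    ~ exists z : int, inside0 s (z%:~R - x).
  split=> [h [z]|h z]; first by rewrite (negbTE (h z)).
  by apply/negP => hz; apply: h; exists z.
have [[fx /no hx]|[fx hx]] := floor_shift s1 x1 x2;
have [[fy /no hy]|[fy hy]] := floor_shift s1 y1 y2;
rewrite DE fx fy; case: (0 < s); split; (lia || tauto).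
Qed.

Lemma balanced_hitsl m n (N : int) (s : R) : (0 < m <= n)%N ->
  s = n%:R * gamma R - N%:~R -> `|s| < 1 ->
  balanced R m n <->
  forall j : nat, (0 < j < m)%N -> (hits j s <-> hits (m%:Z - j%:Z) (- s)).
Proof.
move=> hm sE s1; rewrite balancedP //.
by split=> h j hj; have := h j hj; rewrite second_diffC (second_diff_hits _ _ sE s1) //; lia.
Qed.

Lemma balanced_hitsr m n (M : int) (s : R) : (0 < m <= n)%N ->
  s = m%:R * gamma R - M%:~R -> `|s| < 1 ->
  balanced R m n <->
  forall j : nat, (0 < j < m)%N -> (hits j s <-> hits (n%:Z - j%:Z) (- s)).
Proof.
move=> hm sE s1; rewrite balancedP //.
by split=> h j hj; have := h j hj; rewrite (second_diff_hits _ _ sE s1) //; lia.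
Qed.

Lemma hits_far a (k : int) s : (2 <= a)%N -> 0 < k < (fib a.+1)%:Z ->
  hits k s -> `|psi ^+ a| < `|s|.
Proof.
case: a => [|[|a]] // _ hk /hits_norm[z hz].
by apply: le_lt_trans hz; apply: gamma_dist; lia.
Qed.

Lemma psiX_lt1 a : (0 < a)%N -> `|psi ^+ a| < 1.
Proof. by move=> a0; have := norm_psiX_lt a0; rewrite expr0 normr1. Qed.

(** Both [j] and [m - j] lie below [F_(a+1)], so by [hits_far] neither hits so short an arc: both
    sides of the equivalence are false. *)
Lemma balanced_near m n a (N : int) : (0 < m <= n)%N -> (2 <= a)%N ->
  (m <= fib a.+1)%N -> `|n%:R * gamma R - N%:~R| <= `|psi ^+ a| -> balanced R m n.
Proof.
move=> hm a2 ma hN; apply/(balanced_hitsl hm erefl).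
  by apply: le_lt_trans hN _; apply: psiX_lt1; lia.
move=> j hj; split=> h; exfalso; move: hN; rewrite leNgt => /negP[].
  by apply: (hits_far _ _ h); lia.
by rewrite -[ltRHS]normrN; apply: (hits_far _ _ h); lia.
Qed.

Lemma nearest_int (x : R) : exists N : int, `|x - N%:~R| <= 1 / 2 /\
  forall z : int, `|x - N%:~R| <= `|x - z%:~R|.
Proof.
exists (Num.floor (x + 1 / 2)); have := floor_itv (x + 1 / 2).
set N := Num.floor _; rewrite rmorphD /= mulr1z => /andP[h1 h2].
have h : `|x - N%:~R| <= 1 / 2 by rewrite ler_norml; lra.
split=> // z; have [->//|zN] := eqVneq z N.
apply: le_trans h _; rewrite ler_normr.
have [] : z + 1 <= N \/ N + 1 <= z by lia.
  by rewrite -(ler_int R) rmorphD /= mulr1z; lra.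
by rewrite -(ler_int R) rmorphD /= mulr1z; lra.
Qed.

Lemma fib_gammaE a : (2 <= a)%N ->
  (fib a)%:Z%:~R * gamma R - (fib (a - 2))%:Z%:~R = psi ^+ a.
Proof. by case: a => [|[|a]] // _; rewrite -!pmulrn fib_gamma !subSS subn0; ring. Qed.

Lemma fib_lt_S a : (2 <= a)%N -> (fib a < fib a.+1)%N.
Proof.
case: a => [|[|a]] // _; rewrite [in X in (_ < X)%N]fibSS.
by have := fib_gt0 a; lia.
Qed.

(** The shorter of the two displacements serves as [s]. Hits on both sides of the equivalence would
    add up to bring the multiple of the other number within less than [|s|] of an integer, so
    balance forbids every hit; a Fibonacci point then provides one. *)
Lemma not_balanced_far m n a : (m <= n)%N -> (3 <= a)%N -> (fib a < m)%N ->
  (forall z : int, `|psi ^+ a.-1| < `|m%:R * gamma R - z%:~R|) ->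
  (forall z : int, `|psi ^+ a| < `|n%:R * gamma R - z%:~R|) -> ~ balanced R m n.
Proof.
move=> le_mn a3 ma hm hn bal.
have m0 : (0 < m <= n)%N by lia.
have [M [M1 Mmin]] := nearest_int (m%:R * gamma R).
have [N [N1 Nmin]] := nearest_int (n%:R * gamma R).
have fa0 : (0 < fib a)%N by case: a {ma hm hn} a3 => // a _; apply: fib_gt0.
have [le_nm|lt_mn] := leP `|n%:R * gamma R - N%:~R| `|m%:R * gamma R - M%:~R|.
  have noth (j : nat) : (0 < j < m)%N -> ~ (hits j (n%:R * gamma R - N%:~R)) /\
      ~ (hits (m%:Z - j%:Z) (- (n%:R * gamma R - N%:~R))).
    have := (balanced_hitsl m0 erefl (le_lt_trans N1 _)).1 bal j; rewrite ltr_pdivrMr //.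
    move=> /(_ ltac:(lra)) hb hj; have {}hb := hb hj.
    suff : ~ (hits j (n%:R * gamma R - N%:~R) /\
      hits (m%:Z - j%:Z) (- (n%:R * gamma R - N%:~R))) by tauto.
    case=> h1 h2; have [z] := hitsD h1 h2.
    have -> : j%:Z + (m%:Z - j%:Z) = m by lia.
    by rewrite -pmulrn; have := Mmin z; lra.
  (* Whichever side [psi^a] lies on, it yields a hit, for [j = F_a] or for [j = m - F_a]. *)
  have [] := @inside0_or (n%:R * gamma R - N%:~R) (psi ^+ a) (psi_neq0 a) (hn N).
    move=> h; have [|+ _] := noth (fib a); first lia.
    by apply; exists (fib (a - 2)); rewrite fib_gammaE //; lia.
  move=> h; have [|_ +] := noth (m - fib a)%N; first lia.
  have -> : m%:Z - (m - fib a)%N%:Z = fib a by lia.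
  by apply; exists (fib (a - 2)); rewrite fib_gammaE //; lia.
have noth (j : nat) : (0 < j < m)%N -> ~ (hits j (m%:R * gamma R - M%:~R)).
  have := (balanced_hitsr m0 erefl (le_lt_trans M1 _)).1 bal j; rewrite ltr_pdivrMr //.
  move=> /(_ ltac:(lra)) hb hj; have {}hb := hb hj.
  move=> h1; have [z] := hitsD h1 (hb.1 h1).
  have -> : j%:Z + (n%:Z - j%:Z) = n by lia.
  by rewrite -pmulrn; have := Nmin z; lra.
have ha1 := @noth (fib a.-1) _; have ha := @noth (fib a) ltac:(lia).
case: a a3 ma hm hn fa0 {noth} ha1 ha => [|[|[|a]]] //= _ ma hm hn fa0 ha1 ha.
have la := @fib_lt_S a.+2 isT; have fp := fib_gt0 a.+1.
have {}ha1 := ha1 ltac:(lia); have p := psi_bound.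
(* [psi ^+ a.+2] and [psi ^+ a.+3] have opposite signs and are both shorter than [s], so one of them
   lies on the side of [s]. *)
have [|h] := @inside0_or (m%:R * gamma R - M%:~R) (psi ^+ a.+2) (psi_neq0 _) (hm M).
  by move=> h; apply: ha1; exists (fib (a.+2 - 2)); rewrite fib_gammaE.
apply: ha; exists (fib (a.+3 - 2)); rewrite fib_gammaE // [psi ^+ a.+3]exprS.
by move: h; rewrite /inside0; nra.
Qed.

(** The points [j gamma] with [0 < j < F_a] are too far from 0 to hit the arc up to [psi^a], so only
    hits of [t = n - j] remain to be excluded. *)
Lemma balanced_fib n a : (3 <= a)%N -> (fib a <= n)%N ->
  balanced R (fib a) n <->
  forall t : nat, (n - fib a < t < n)%N -> ~ hits t (- psi ^+ a).
Proof.
move=> a3 an; have fa0 : (0 < fib a)%N by case: a {an} a3 => // a _; apply: fib_gt0.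
have m0 : (0 < fib a <= n)%N by lia.
have sE : psi ^+ a = (fib a)%:R * gamma R - (fib (a - 2))%:Z%:~R.
  by rewrite -fib_gammaE -?pmulrn //; lia.
have no (j : nat) : (0 < j < fib a)%N -> ~ hits j (psi ^+ a).
  move=> hj h; have := norm_psiX_le (leq_pred a); rewrite leNgt => /negP[].
  by apply: (hits_far _ _ h); rewrite ?prednK; lia.
rewrite (balanced_hitsr m0 sE) ?psiX_lt1 //; last by lia.
split=> h t ht.
  have hj : (0 < n - t < fib a)%N by lia.
  have := h _ hj; have -> : n%:Z - (n - t)%N%:Z = t by lia.
  by have := no _ hj; tauto.
have := h (n - t)%N ltac:(lia); have -> : n%:Z - t%:Z = (n - t)%N by lia.
by have := no _ ht; tauto.
Qed.

(** * Zeckendorf expansions *)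

Lemma psiX_even k : ~~ odd k -> psi ^+ k = `|psi ^+ k|.
Proof. by move=> /negbTE ok; rewrite [LHS]psiX_sign ok expr0 mul1r. Qed.

Lemma psiX_odd k : odd k -> psi ^+ k = - `|psi ^+ k|.
Proof. by move=> ok; rewrite [LHS]psiX_sign ok expr1 mulN1r. Qed.

Lemma psiX_even_itv k : ~~ odd k -> (2 <= k)%N -> 0 < psi ^+ k <= psi ^+ 2.
Proof.
move=> ok k2; have := norm_psiX_le k2.
by rewrite -(@psiX_even 2) // -(psiX_even ok) => ->; rewrite psiX_even // psiX_gt0.
Qed.

Lemma psiX_odd_itv k l : odd k -> odd l -> (l <= k)%N -> psi ^+ l <= psi ^+ k < 0.
Proof.
move=> ok ol lk; rewrite (psiX_odd ok) (psiX_odd ol) lerN2 norm_psiX_le //.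
by rewrite oppr_lt0 psiX_gt0.
Qed.

(* For the Zeckendorf expansion of [N], the difference between [N gamma] and
   an integer: see [conj_sumE]. *)
Definition conj_sum (s : seq nat) : R := \sum_(x <- s) psi ^+ x.

Lemma conj_sum_rcons s z : conj_sum (rcons s z) = conj_sum s + psi ^+ z.
Proof. by rewrite /conj_sum big_rcons /= addrC. Qed.

Lemma conj_sumE s : all (fun x => 2 <= x)%N s ->
  (\sum_(x <- s) fib x)%N%:R * gamma R - (\sum_(x <- s) fib (x - 2))%N%:Z%:~R = conj_sum s.
Proof.
rewrite /conj_sum; elim: s => [|x s IH] /=; first by rewrite !big_nil mul0r subr0.
case/andP=> x2 /IH {}IH; rewrite !big_cons -IH -(fib_gammaE x2) -!pmulrn !natrD.
by ring.
Qed.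

(** The bounds are the limits of the extreme patterns: [psi^3 + psi^5 + ... = - psi^2] and
    [psi^2 + psi^4 + ... = - psi]. The induction factors out the smallest exponent. *)
Lemma conj_sum_bound x s : pairwise (fun x y => y + 2 <= x)%N s ->
  all (fun y => x + 2 <= y)%N s ->
  exists t, conj_sum s = psi ^+ x * t /\ - psi ^+ 2 < t < - psi.
Proof.
have p := psi_bound; have p2 := psi_sqr.
elim/last_ind: s x => [|s z IH] x.
  by move=> _ _; exists 0; rewrite /conj_sum big_nil mulr0; split=> //; lra.
rewrite pairwise_rcons all_rcons => /andP[hz /IH{}IH] /andP[xz _].
have [t [E ht]] := IH z hz; exists (psi ^+ (z - x) * (1 + t)); split.
  rewrite conj_sum_rcons E mulrA -exprD subnKC; last by lia.
  by ring.
have p3 : psi ^+ 3 = psi * (psi + 1) by rewrite exprS psi_sqr.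
case: (boolP (odd (z - x))) => o.
  by have := @psiX_odd_itv _ 3 o isT ltac:(lia); rewrite p3; nra.
by have := psiX_even_itv o ltac:(lia); nra.
Qed.

Lemma conj_sum_last s z : pairwise (fun x y => y + 2 <= x)%N (rcons s z) ->
  exists t, conj_sum (rcons s z) = psi ^+ z * t /\ - psi < t < 1 - psi.
Proof.
rewrite pairwise_rcons => /andP[hz hs]; have [t [E ht]] := conj_sum_bound hs hz.
exists (1 + t); rewrite conj_sum_rcons E; split; first by ring.
by have := psi_sqr; lra.
Qed.

(** [t - 1] is [psi^(w-z)] times a positive factor, so its sign is the parity of [w - z]; hence the
    parity condition in (d). *)
Lemma conj_sum_last2 s w z : pairwise (fun x y => y + 2 <= x)%N (rcons (rcons s w) z) ->
  exists t, conj_sum (rcons (rcons s w) z) = psi ^+ z * t /\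
    (if odd w == odd z then 1 < t else 0 < t < 1).
Proof.
move=> h; move: (h); rewrite pairwise_rcons all_rcons => /andP[/andP[wz _] hs].
have [t [E ht]] := conj_sum_last hs; exists (1 + psi ^+ (w - z) * t); split.
  rewrite conj_sum_rcons E mulrDr mulr1 mulrA -exprD subnKC; last by lia.
  by rewrite addrC.
have p := psi_bound; have p2 := psi_sqr.
have p3 : psi ^+ 3 = psi * (psi + 1) by rewrite exprS psi_sqr.
have wz2 : (2 <= w - z)%N by lia.
have oE : odd (w - z) = odd w (+) odd z by rewrite oddB //; lia.
have [o|o] := eqVneq (odd w) (odd z); move: oE; rewrite ?o ?addbb => oE.
  by have := psiX_even_itv (negbT oE) wz2; nra.
have {}oE : odd (w - z) by rewrite oE; case: (odd w) (odd z) o => [] [].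
have wz3 : (3 <= w - z)%N by move: oE wz2; case: (w - z)%N => [|[|[]]].
by have := @psiX_odd_itv _ 3 oE isT wz3; rewrite p3; nra.
Qed.

(** [conj_sum s] lies between [- psi^2] and [- psi], an interval of length 1, so any other integer
    is at distance above [psi^2]. *)
Lemma zeckendorf_rep k s (z : int) : zeckendorf k s ->
  k%:R * gamma R - z%:~R = conj_sum s \/ psi ^+ 2 < `|k%:R * gamma R - z%:~R|.
Proof.
case=> s2 gap ->; have := conj_sumE s2; set S := (\sum_(x <- s) fib (x - 2))%N => E.
have [t [tE ht]] := @conj_sum_bound 0 s gap s2; rewrite expr0 mul1r in tE.
have p := psi_bound; have p2 := psi_sqr.
have [->|zS] := eqVneq z S; [by left | right].
rewrite ltr_normr; apply/orP; have [|] : z + 1 <= S \/ S%:Z + 1 <= z by lia.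
  by rewrite -(ler_int R) rmorphD /= mulr1z; lra.
by rewrite -(ler_int R) rmorphD /= mulr1z; lra.
Qed.

Lemma zeckendorf_far k s z (l : int) : zeckendorf k (rcons s z) ->
  `|psi ^+ z.+1| < `|k%:R * gamma R - l%:~R|.
Proof.
move=> zk; have [|h] := zeckendorf_rep l zk.
  move=> ->; case: zk => _ gap _; have [t [-> ht]] := conj_sum_last gap.
  rewrite norm_psiS [ltRHS]normrM mulrC ltr_pM2l ?psiX_gt0 //.
  by rewrite ltr_normr; lra.
apply: le_lt_trans h; rewrite (@psiX_even 2) // norm_psiX_le //.
by case: zk; rewrite all_rcons => /andP[]; lia.
Qed.

Lemma zeckendorf_lt s h : all (fun x => 2 <= x)%N s ->
  pairwise (fun x y => y + 2 <= x)%N s -> all (fun x => x <= h)%N s ->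
  (\sum_(x <- s) fib x < fib h.+1)%N.
Proof.
elim: s h => [|x s IH] h /=; first by rewrite big_nil fib_gt0.
case/andP=> x2 s2 /andP[xs gap] /andP[xh _]; rewrite big_cons.
have := IH (x - 2)%N s2 gap; have -> : (x - 2).+1 = x.-1 by lia.
have le_fib := @leq_fib x.+1 h.+1 ltac:(lia).
have := fibSS x.-1; rewrite prednK; last by lia.
move=> fE /(_ _) lt; apply: leq_trans le_fib; rewrite fE ltn_add2l; apply: lt.
by apply: sub_all xs => y; lia.
Qed.

(** * Balance when [m] is a Fibonacci number *)

Lemma inside0P s u : s != 0 ->
  inside0 s u <-> exists2 t, u = s * t & 0 < t < 1.
Proof.
move=> s0; have [h|h] : 0 < s \/ s < 0 by case: (ltgtP s 0) s0 => //; auto.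
  rewrite /inside0; split=> [hu|[t -> ht]]; last by apply/orP; left; nra.
  exists (u / s); first by rewrite mulrC divfK.
  by rewrite divr_gt0 ?ltr_pdivrMr //; lra.
rewrite /inside0; split=> [hu|[t -> ht]]; last by apply/orP; right; nra.
exists (u / s); first by rewrite mulrC divfK.
by rewrite ltr_ndivrMr // -(mulrNN u) -invrN divr_gt0 //; lra.
Qed.

(** With [N'] the part of [n] above index [a], every [t] concerned has [0 < t - N' < F_(a+1)]. A hit
    would give [(t - N') gamma] modulo 1 a factor of [psi^a] strictly between [psi - 1] and [psi^2],
    which [gamma_approx] forbids. *)
Lemma balanced_fib_mem n a p q : (3 <= a)%N -> zeckendorf n (p ++ a :: q) ->
  balanced R (fib a) n.
Proof.
move=> a3 [all2 gap nE].
move: all2 gap; rewrite all_cat /= pairwise_cat /= allrel_consr.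
move=> /andP[p2 /andP[_ q2]] /and3P[/andP[pa _] gp /andP[qa gq]].
move: nE; rewrite big_cat big_cons /=; set N' := (\sum_(x <- p) _)%N.
have := @zeckendorf_lt q a.-2 q2 gq.
set r := (\sum_(x <- q) _)%N => hr nE; have {}hr : (r < fib a.-1)%N.
  rewrite -[a.-1]prednK; last by lia.
  by apply: hr; apply: sub_all qa => y; lia.
have fE : fib a.+1 = (fib a + fib a.-1)%N by case: (a) a3.
rewrite balanced_fib //; last by lia.
move=> t ht [z hz].
have sN : - psi ^+ a != 0 by rewrite oppr_eq0 psi_neq0.
have [th uE hth] := (inside0P _ sN).1 hz.
have [t' [cE ht']] := conj_sum_bound gp pa.
have := conj_sumE p2; rewrite -/N' cE; set S := (\sum_(x <- p) _)%N => E.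
case: a a3 fE hr nE ht hz sN uE cE E {pa qa} => [|[|a]] // a3 fE hr nE ht hz sN uE cE E.
have [|ta [taE hta]] := @gamma_approx a (t%:Z - N'%:Z) (z - S%:Z).
  by move: ht hr nE fE; clear; lia.
have pb := psi_bound; have p22 := psi_sqr.
suff taE' : ta = - th - t' by lra.
apply: (mulfI (psi_neq0 a.+2)); rewrite -taE !rmorphB /=.
by move: uE E; rewrite -!pmulrn; lra.
Qed.

(** For [d > 0] the factor [- v] falls in the gap left by [gamma_approx]; for [d < 0] so does
    [psi v], one index lower, being between -1 and 0. For [d = 0], [|z| < 1] forces [z = 0], while
    [v] is positive. *)
Lemma gamma_no_approx a (d z : int) v : (3 <= a)%N -> `|d| < (fib a)%:Z ->
  d%:~R * gamma R - z%:~R = - (psi ^+ a * v) -> 0 < v < 1 - psi -> False.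
Proof.
case: a => [|[|[|a]]] // _ hd DE hv.
have [d0|[d0|d0]] : (0 < d < (fib a.+4)%:Z \/ 0 < - d < (fib a.+3)%:Z \/ d = 0).
  by move: hd (@fib_lt_S a.+3 isT); clear; lia.
all: have p := psi_bound; have p2 := psi_sqr.
- have [ta [taE hta]] := gamma_approx z d0.
  suff : ta = - v by lra.
  by apply: (mulfI (psi_neq0 a.+3)); rewrite -taE DE mulrN.
- have [ta [taE hta]] := gamma_approx (- z) d0.
  suff : ta = psi * v by nra.
  apply: (mulfI (psi_neq0 a.+2)); rewrite -taE !rmorphN /= mulNr -opprD DE opprK.
  by rewrite mulrA -exprSr.
- move: DE; rewrite d0 mul0r sub0r => /oppr_inj zE.
  have z1 : `|z%:~R : R| < 1.
    rewrite zE normrM (gtr0_norm (_ : 0 < v)); last by lra.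
    have := @norm_psiX_le 2 a.+3 isT; rewrite -(@psiX_even 2) // => h.
    by have := psiX_gt0 a.+3; nra.
  have z0 : z = 0.
    by move: z1; rewrite -intr_norm -[1](mulr1z 1) ltr_int; clear; lia.
  by move/eqP: zE; rewrite z0 eq_sym mulf_eq0 (negbTE (psi_neq0 _)) /= => /eqP; lra.
Qed.

(** The part [N'] of [n] above [a] is within [F_a] of every [t] concerned, so a hit would contradict
    [gamma_no_approx]. *)
Lemma balanced_fib_parity n a hi w lo : (3 <= a)%N -> (fib a <= n)%N ->
  zeckendorf n (rcons hi w ++ lo) -> (a < w)%N -> odd a = odd w ->
  all (fun x => x < a)%N lo -> balanced R (fib a) n.
Proof.
move=> a3 an [all2 gap nE] aw oaw loa.
have wa_even : ~~ odd (w - a) by rewrite oddB ?oaw ?addbb // ltnW.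
have wa2 : (2 <= w - a)%N by move: aw wa_even; rewrite -subn_gt0; case: (w - a)%N => [|[]].
move: all2 gap; rewrite all_cat pairwise_cat => /andP[p2 q2] /and3P[_ gp gq].
move: nE; rewrite big_cat /=; set N' := (\sum_(x <- rcons hi w) _)%N.
have := @zeckendorf_lt lo a.-1 q2 gq.
set r := (\sum_(x <- lo) _)%N; rewrite prednK; last by lia.
move=> hr nE; have {}hr : (r < fib a)%N by apply: hr; apply: sub_all loa => y; lia.
rewrite balanced_fib // => t ht [z hz].
have sN : - psi ^+ a != 0 by rewrite oppr_eq0 psi_neq0.
have [th uE hth] := (inside0P _ sN).1 hz.
have [t' [cE ht']] := conj_sum_last gp.
have := conj_sumE p2; rewrite -/N' cE; set S := (\sum_(x <- rcons hi w) _)%N => E.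
have p := psi_bound; have p22 := psi_sqr.
have := psiX_even_itv wa_even wa2 => hrho.
have wE : psi ^+ w = psi ^+ a * psi ^+ (w - a) by rewrite -exprD subnKC // ltnW.
(* The upper bound uses [psi^(w-a) <= psi^2] and [psi^2 (1 - psi) = - psi]. *)
set v := th + psi ^+ (w - a) * t'; have hv : 0 < v < 1 - psi by rewrite /v; nra.
have DE : (t%:Z - N'%:Z)%:~R * gamma R - (z - S%:Z)%:~R = - (psi ^+ a * v).
  by rewrite !rmorphB /= /v mulrDr mulrA -wE; move: uE E; rewrite -!pmulrn; lra.
apply: (gamma_no_approx a3 _ DE hv).
by move: ht hr nE; clear; lia.
Qed.

(** The hit is at [N'], the part of [n] above [a]: [w - a] being odd puts [N' gamma] on the side of
    [- psi^a], and [lo] being nonempty makes [N' < n]. *)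
Lemma not_balanced_fib_parity n a hi w lo : (3 <= a)%N -> (fib a <= n)%N ->
  zeckendorf n (rcons hi w ++ lo) -> (a < w)%N -> odd a <> odd w ->
  lo != [::] -> all (fun x => x < a)%N lo -> ~ balanced R (fib a) n.
Proof.
move=> a3 an [all2 gap nE] aw oaw lo0 loa.
have wa_odd : odd (w - a) by rewrite oddB ?(ltnW aw) //; case: (odd w) (odd a) oaw => [] [].
move: all2 gap; rewrite all_cat pairwise_cat => /andP[p2 q2] /and3P[_ gp gq].
move: nE; rewrite big_cat /=; set N' := (\sum_(x <- rcons hi w) _)%N.
have := @zeckendorf_lt lo a.-1 q2 gq; rewrite prednK; last by lia.
have : (0 < \sum_(x <- lo) fib x)%N.
  case: lo lo0 q2 {loa gq} => // x lo _ /andP[x2 _]; rewrite big_cons.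
  by case: x x2 => // x _; have := fib_gt0 x; lia.
set r := (\sum_(x <- lo) _)%N => r0 hr nE.
have {}hr : (r < fib a)%N by apply: hr; apply: sub_all loa => y; lia.
rewrite balanced_fib // => /(_ N' ltac:(lia)); apply.
exists (\sum_(x <- rcons hi w) fib (x - 2))%N%:Z; rewrite -pmulrn conj_sumE //.
apply/inside0P; first by rewrite oppr_eq0 psi_neq0.
have [t [-> ht]] := conj_sum_last gp.
have p := psi_bound; have p22 := psi_sqr.
exists (- (psi ^+ (w - a) * t)).
  by rewrite mulrNN mulrA -exprD subnKC // ltnW.
have := @psiX_odd_itv _ 1 wa_odd isT (odd_gt0 wa_odd); rewrite expr1; nra.
Qed.

(** * Balance for general [m] *)

Lemma balanced_above m n a s z : (0 < m <= n)%N -> (2 <= a)%N -> (m <= fib a.+1)%N ->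
  zeckendorf n (rcons s z) -> (a < z)%N -> balanced R m n.
Proof.
move=> hm a2 ma [all2 gap nE] az.
have := conj_sumE all2; rewrite -nE => E.
suff h : `|conj_sum (rcons s z)| <= `|psi ^+ a|.
  by rewrite -E in h; exact: balanced_near hm a2 ma h.
have [t [-> ht]] := conj_sum_last gap.
apply: le_trans (norm_psiX_le (_ : a <= z.-1)%N); last by lia.
have p := psi_bound; have p2 := psi_sqr.
case: z az {all2 gap nE E} => // z az.
rewrite [leLHS]normrM norm_psiS (gtr0_norm (_ : 0 < t)); last by lra.
(* [- psi t] is at most 1, since [t < 1 - psi] and [- psi (1 - psi) = 1]. *)
by rewrite mulrAC ler_piMl //; nra.
Qed.

Lemma balanced_at m n a s w : (0 < m <= n)%N -> (2 <= a)%N -> (m <= fib a.+1)%N ->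
  zeckendorf n (rcons (rcons s w) a) -> odd w != odd a -> balanced R m n.
Proof.
move=> hm a2 ma [all2 gap nE] /negbTE o.
have := conj_sumE all2; rewrite -nE => E.
suff h : `|conj_sum (rcons (rcons s w) a)| <= `|psi ^+ a|.
  by rewrite -E in h; exact: balanced_near hm a2 ma h.
have [t [-> ]] := conj_sum_last2 gap; rewrite o => ht.
by rewrite [leLHS]normrM ler_piMr // ler_norml; lra.
Qed.

(** The smallest index of [m] is at most [a - 2], so [m > F_a], and [zeckendorf_far] keeps [m gamma]
    farther than [|psi^(a-1)|] from the integers. *)
Lemma not_balanced_nonfib m n a s t : (m <= n)%N -> (3 <= a)%N ->
  zeckendorf m (a :: s) -> s != [::] -> zeckendorf n t ->
  (forall z : int, `|psi ^+ a| < `|n%:R * gamma R - z%:~R|) -> ~ balanced R m n.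
Proof.
move=> le_mn a3 zm s0 zn far; case/lastP: s s0 zm => // s z _ zm.
apply: (@not_balanced_far m n a) => //.
  case: zm => + _ ->; rewrite big_cons big_rcons /= all_rcons => /and3P[_ z2 _].
  by case: z z2 => // z _; have := fib_gt0 z; lia.
move=> l; apply: le_lt_trans (zeckendorf_far l (zm : zeckendorf m (rcons (a :: s) z))).
case: zm => _ + _; rewrite /= all_rcons => /andP[/andP[za _] _].
by apply: norm_psiX_le; lia.
Qed.

Lemma not_balanced_last m n a s bs z : (m <= n)%N -> (3 <= a)%N ->
  zeckendorf m (a :: s) -> s != [::] -> zeckendorf n (rcons bs z) -> (z < a)%N ->
  ~ balanced R m n.
Proof.
move=> le_mn a3 zm s0 zn za; apply: (not_balanced_nonfib le_mn a3 zm s0 zn) => l.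
by apply: le_lt_trans (zeckendorf_far l zn); apply: norm_psiX_le.
Qed.

Lemma not_balanced_last2 m n a s bs w : (m <= n)%N -> (3 <= a)%N ->
  zeckendorf m (a :: s) -> s != [::] -> zeckendorf n (rcons (rcons bs w) a) ->
  odd w = odd a -> ~ balanced R m n.
Proof.
move=> le_mn a3 zm s0 zn o; apply: (not_balanced_nonfib le_mn a3 zm s0 zn) => l.
have [->|h] := zeckendorf_rep l zn.
  case: zn => _ gap _; have [t [-> ht]] := conj_sum_last2 gap.
  move: ht; rewrite o eqxx => ht; rewrite [ltRHS]normrM ltr_pMr ?psiX_gt0 //.
  by rewrite ltr_normr ht.
apply: le_lt_trans h; rewrite (@psiX_even 2) // norm_psiX_le //.
exact: ltnW.
Qed.

End Golden.

(** * Reading the cases off the two expansions *)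

Lemma zeckendorf_head_bounds m a s : zeckendorf m (a :: s) ->
  (fib a <= m < fib a.+1)%N.
Proof.
case=> all2 gap ->; rewrite zeckendorf_lt //=; first by rewrite big_cons leq_addr.
rewrite leqnn /=; move: gap => /= /andP[ha _].
by apply: sub_all ha => x; lia.
Qed.

Lemma zeckendorf_split n b a j : zeckendorf n b -> (0 < j < size b)%N ->
  (entry b j.+1 < a < entry b j)%N ->
  [/\ b = rcons (take j.-1 b) (entry b j) ++ drop j b,
      drop j b != [::] & all (fun x => x < a)%N (drop j b)].
Proof.
case=> _ gap _ /andP[j0 jb] /andP[ja aj].
split.
- rewrite /entry -take_nth; last by lia.
  by rewrite prednK // cat_take_drop.
- by rewrite -size_eq0 size_drop subn_eq0 -ltnNge.
move: gap; rewrite -{1}(cat_take_drop j b) pairwise_cat => /and3P[_ _].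
rewrite (drop_nth 0%N jb) /= => /andP[h _].
rewrite [entry b j.+1]/(nth 0%N b j) in ja; rewrite ja /=.
by apply: sub_all h => x hx; apply: leq_ltn_trans ja; apply: leq_trans hx; apply: leq_addr.
Qed.

Lemma zeckendorf_gap n bs z a : zeckendorf n (rcons bs z) -> (fib a <= n)%N ->
  a \notin rcons bs z -> (z < a)%N ->
  exists2 j, (0 < j < size (rcons bs z))%N &
    (entry (rcons bs z) j.+1 < a < entry (rcons bs z) j)%N.
Proof.
(* The position of the first entry below [a], counted from 0, is the index counted from 1 of the
   entry before it. *)
set b := rcons bs z => zb an ab za; set j := find (fun x => x < a)%N b.
have hasj : has (fun x => x < a)%N b by apply/hasP; exists z; rewrite ?mem_rcons ?mem_head.
have jb : (j < size b)%N by rewrite -has_find.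
have ja : (nth 0 b j < a)%N := nth_find 0%N hasj.
(* Otherwise the largest index is below [a], giving [n < F_a]. *)
have j0 : (0 < j)%N.
  rewrite lt0n; apply/negP => /eqP j0; rewrite j0 in ja.
  move: zb ja an; case: (b) => [[_ _ ->]|x s /zeckendorf_head_bounds /andP[_ h] /= xa].
    by rewrite big_nil; case: (a) za => // c _; have := fib_gt0 c; lia.
  by have := leq_fib xa; lia.
exists j; rewrite ?j0 // /entry /= ja /= ltn_neqAle; apply/andP; split.
  by apply: (contraNneq _ ab) => ->; apply: mem_nth; apply: leq_ltn_trans (leq_pred j) jb.
rewrite leqNgt; have := @before_find _ 0%N (fun x => x < a)%N b j.-1.
by rewrite -/j prednK // => /(_ (leqnn j)) /= ->.
Qed.

Theorem theorem7 (R : realType) (m n : nat) (a b : seq nat)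
    (le_mn : (m <= n)%N) (zeck_m : zeckendorf m a) (zeck_n : zeckendorf n b) :
  balanced R m n <->
  (m = 0%N \/ m = 1%N) \/
  (0 < size a /\ m = fib (entry a 1) /\ entry a 1 \notin b /\
     exists j : nat,
       0 < j < size b /\
       entry b j.+1 < entry a 1 < entry b j /\
       odd (entry a 1) = odd (entry b j))%N \/
  (0 < size a /\ m = fib (entry a 1) /\ entry a 1 \in b)%N \/
  (0 < size a /\ 1 < size b /\ entry a 1 = entry b (size b) /\
     odd (entry b (size b)) <> odd (entry b (size b).-1))%N \/
  (0 < size a /\ 0 < size b /\ entry a 1 < entry b (size b))%N.
Proof.
have [m1|m2] := leqP m 1.
  split=> _; first by left; case: m m1 {le_mn zeck_m} => [|[]] //; [left | right].
  case: m m1 le_mn {zeck_m} => [|[|//]] _ le_mn.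
    by exists 0, 0 => i; left; rewrite /rect_sum big_ord0.
  by apply/(balancedP R (_ : 0 < 1 <= n)%N) => // j; lia.
case: a zeck_m => [[_ _ m0]|a s zm]; first by rewrite m0 big_nil in m2.
have [fa_le lt_fa] := andP (zeckendorf_head_bounds zm).
(* [2 <= m < F_(a+1)] and [F_3 = 2] exclude [a = 2]. *)
have a3 : (3 <= a)%N.
  case: zm => /andP[a2 _] _ _; case: a a2 lt_fa {fa_le} => [|[|[|a]]] //.
  by rewrite /fib /=; lia.
have a2 : (2 <= a)%N := ltnW a3.
have hm : (0 < m <= n)%N by rewrite le_mn ltnW.
have nonfib : m <> fib a -> s != [::].
  by case: zm => _ _ ->; case: (s) => // []; rewrite big_cons big_nil addn0.
rewrite -[entry (a :: s) 1]/a.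
case/lastP: b zeck_n => [[_ _ n0]|bs z zn].
  by move: le_mn m2; rewrite n0 big_nil; lia.
have lastE : entry (rcons bs z) (size (rcons bs z)) = z.
  by rewrite /entry size_rcons /= nth_rcons ltnn eqxx.
rewrite lastE; split.
  move=> bal; right; have [az|za|az] := ltngtP a z.
  - by right; right; right; rewrite size_rcons.
  - have [mE|/eqP/nonfib s0] := eqVneq m (fib a); last first.
      by case: (not_balanced_last le_mn a3 zm s0 zn za bal).
    have [ab|ab] := boolP (a \in rcons bs z); first by right; left.
    left; split=> //; split=> //; split=> //.
    have an : (fib a <= n)%N by rewrite -mE.
    have [j jb ja] := zeckendorf_gap zn an ab za; exists j; split=> //; split=> //.
    apply/eqP/negP => /negP/eqP o; have [bE lo0 lo] := zeckendorf_split zn jb ja.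
    rewrite bE in zn; case/andP: ja => _ ja.
    by case: (not_balanced_fib_parity (R := R) a3 an zn ja o lo0 lo); rewrite -mE.
  - have [mE|/eqP mE] := eqVneq m (fib a).
      by right; left; rewrite -az mem_rcons mem_head.
    (* If [z = a] were the only index, then [n = F_a <= m <= n] and [m = F_a]. *)
    case/lastP: bs zn lastE => [[_ _ nE]|bs w zn] lastE.
      by case: mE; move: le_mn fa_le; rewrite nE /= big_cons big_nil -az; lia.
    have s0 := nonfib mE; right; right; left.
    have wE : entry (rcons (rcons bs w) z) (size (rcons (rcons bs w) z)).-1 = w.
      by rewrite /entry !size_rcons /= !nth_rcons size_rcons ltnSn ltnn eqxx.
    rewrite wE !size_rcons; split=> //; split=> //; split=> // o.
    by rewrite -az in zn o; apply: (not_balanced_last2 le_mn a3 zm s0 zn _ bal).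
move=> [|[|[|[|]]]].
- by lia.
- case=> _ [mE [ab [j [jb [ja o]]]]].
  have [bE lo0 lo] := zeckendorf_split zn jb ja.
  rewrite bE in zn; case/andP: ja => _ ja; rewrite mE.
  by apply: (balanced_fib_parity R a3 _ zn ja o lo); rewrite -mE.
- case=> _ [mE /splitPr ab]; case: ab zn => p q zn; rewrite mE.
  exact: balanced_fib_mem zn.
- case=> _ [b1 [az o]]; rewrite -az in zn o.
  case/lastP: bs zn b1 o {lastE} => [//|bs w] zn _.
  rewrite /entry !size_rcons /= !nth_rcons size_rcons ltnSn ltnn eqxx => o.
  by apply: (balanced_at R hm a2 (ltnW lt_fa) zn); apply/eqP => /esym.
- by case=> _ [_ az]; apply: (balanced_above R hm a2 (ltnW lt_fa) zn az).
Qed.
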